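(* Let $d=2$, fix the grid (with mesh size $h>0$) and $\alpha\in[-1,2)$, and for $\delta>0$ let $$\rho_\delta(|\boldsymbol s|)=\frac{C^\alpha_\delta}{|\boldsymbol s|^{2+\alpha}},\qquad C^\alpha_\delta=\frac{2(2-\alpha)}{\pi}\,\delta^{\alpha-2}.$$ Then the corresponding nonlocal stiffness matrices $\boldsymbol S_\delta$ satisfy $$\lim_{\delta\to0^+}\boldsymbol S_\delta=\boldsymbol S_h\otimes\boldsymbol M_h+\boldsymbol M_h\otimes\boldsymbol S_h,$$ where $\boldsymbol S_h$ and $\boldsymbol M_h$ are the tridiagonal one-dimensional FEM stiffness and mass matrices $\boldsymbol S_h=\frac1h\,\mathrm{tridiag}(-1,2,-1)$ and $\boldsymbol M_h=\frac h6\,\mathrm{tridiag}(1,4,1)$, the first Kronecker factor in each product being of size $N_2\times N_2$ and the second of size $N_1\times N_1$. That is, the limit is the usual FEM stiffness matrix of the Laplacian.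
   Context: Domain and grid: $\Omega=(a_1,b_1)\times(a_2,b_2)$ and $\widetilde\Omega=(a_1-\delta,b_1+\delta)\times(a_2-\delta,b_2+\delta)$. For $j=1,2$, $N_j\ge1$ is an integer and $h=(b_j-a_j)/(N_j+1)$ is the same for $j=1,2$. Grid points are $\xi_{j,n_j}=a_j+n_jh$, $0\le n_j\le N_j+1$. Basis: for $1\le n_j\le N_j$, $\phi_{n_j}(x_j)$ is the hat function equal to $(x_j-\xi_{j,n_j-1})/h$ on $(\xi_{j,n_j-1},\xi_{j,n_j})$, equal to $(\xi_{j,n_j+1}-x_j)/h$ on $(\xi_{j,n_j},\xi_{j,n_j+1})$ (value $1$ at $\xi_{j,n_j}$), and zero elsewhere (extended by zero to all of $\mathbb{R}$). Bilinear form ($\mathbb{B}^2_\delta$ is the disc of radius $\delta$ centered at $0$): $$\mathcal{A}_\delta(u,v)=\frac12\int_{\widetilde\Omega}\int_{\mathbb{B}^2_\delta}(u(\boldsymbol x+\boldsymbol s)-u(\boldsymbol x))(v(\boldsymbol x+\boldsymbol s)-v(\boldsymbol x))\rho_\delta(|\boldsymbol s|)\,\mathrm{d}\boldsymbol s\,\mathrm{d}\boldsymbol x.$$ The stiffness matrix $\boldsymbol S_\delta\in\mathbb{R}^{N_1N_2\times N_1N_2}$ has entries $(\boldsymbol S_\delta)_{ll'}=\mathcal{A}_\delta(\phi_{n_1}\phi_{n_2},\phi_{m_1}\phi_{m_2})$ with $l=(n_2-1)N_1+n_1$, $l'=(m_2-1)N_1+m_1$. $\mathrm{tridiag}(a,b,a)$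 denotes the tridiagonal matrix with diagonal entries $b$ and off-diagonal entries $a$; the limit of matrices is entrywise. *)

(* Defs.v *)
From HB Require Import structures.
From mathcomp Require Import all_boot all_order all_algebra.
From mathcomp Require Import all_classical all_reals all_analysis.
From mathcomp Require Export mxtens.

Set Implicit Arguments.
Unset Strict Implicit.
Unset Printing Implicit Defensive.

Import Order.TTheory GRing.Theory Num.Theory.
Import numFieldNormedType.Exports.

Local Open Scope classical_set_scope.
Local Open Scope ring_scope.

(* The library norm on R * R is the sup norm, so |s| is spelled out. *)
Definition enorm2 {R : realType} (s : R * R) : R :=
  Num.sqrt (s.1 ^+ 2 + s.2 ^+ 2).

Definition disc {R : realType} (delta : R) : set (R * R) :=
  [set s | enorm2 s < delta].

Definition extended_domain {R : realType} (a1 b1 a2 b2 delta : R) :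
    set (R * R) :=
  `]a1 - delta, b1 + delta[ `*` `]a2 - delta, b2 + delta[.

Definition lebesgue2 {R : realType} :=
  (@lebesgue_measure R \x @lebesgue_measure R)%E.

(* At s = 0 this is 0, since 0 `^ (2 + alpha) = 0 for alpha != -2 and
   0^-1 = 0; the origin is a null set. *)
Definition rho {R : realType} (alpha delta r : R) : R :=
  (2 * (2 - alpha) / pi * delta `^ (alpha - 2)) / r `^ (2 + alpha).

Definition nonlocal_form {R : realType} (a1 b1 a2 b2 delta : R)
    (kernel : R -> R) (u v : R * R -> R) : R :=
  2^-1 * fine (\int[lebesgue2]_(x in extended_domain a1 b1 a2 b2 delta)
    \int[lebesgue2]_(s in disc delta)
      ((u (x.1 + s.1, x.2 + s.2) - u x) *
       (v (x.1 + s.1, x.2 + s.2) - v x) * kernel (enorm2 s))%:E)%E.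

Definition node {R : realType} (a h : R) (n : nat) : R := a + n%:R * h.

(* Meaningful for 0 < n. *)
Definition hat {R : realType} (a h : R) (n : nat) (x : R) : R :=
  if node a h n.-1 < x <= node a h n then (x - node a h n.-1) / h
  else if node a h n < x < node a h n.+1 then (node a h n.+1 - x) / h
  else 0.

(* Unknowns are numbered from 0: the index l : 'I_(N2 * N1) is
   i2 * N1 + i1 with (i2, i1) = mxtens_unindex l, and stands for the node
   (n1, n2) = (i1.+1, i2.+1).  This is the ordering (n2 - 1) N1 + n1 and also
   the one used by the Kronecker product *t. *)
Definition basis2 {R : realType} (a1 a2 h : R) (N1 N2 : nat)
    (l : 'I_(N2 * N1)) (x : R * R) : R :=
  hat a1 h (mxtens_unindex l).2.+1 x.1 * hat a2 h (mxtens_unindex l).1.+1 x.2.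

Definition nonlocal_stiffness {R : realType} (a1 b1 a2 b2 h : R)
    (N1 N2 : nat) (alpha delta : R) : 'M[R]_(N2 * N1) :=
  \matrix_(l, l') nonlocal_form a1 b1 a2 b2 delta (rho alpha delta)
    (basis2 a1 a2 h l) (basis2 a1 a2 h l').

Definition tridiag {R : realType} (n : nat) (lo d up : R) : 'M[R]_n :=
  \matrix_(i, j) (if i == j then d
                  else if i == j.+1 :> nat then lo
                  else if j == i.+1 :> nat then up
                  else 0).

Definition fem_stiffness {R : realType} (h : R) (n : nat) : 'M[R]_n :=
  h^-1 *: tridiag n (-1) 2 (-1).

Definition fem_mass {R : realType} (h : R) (n : nat) : 'M[R]_n :=
  (h / 6) *: tridiag n 1 4 1.

(* Main.v *)
From HB Require Import structures.
Require Import Defs.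
From mathcomp Require Import all_boot all_order all_algebra.
From mathcomp Require Import all_classical all_reals all_analysis.
From mathcomp Require Import measurable_realfun.
From mathcomp Require Import ring lra.

Import Order.TTheory GRing.Theory Num.Theory.
Import numFieldNormedType.Exports.

Local Open Scope classical_set_scope.
Local Open Scope ring_scope.

(** Why the limit is the FEM matrix.  For a piecewise bilinear u and a small
shift s, u(x + s) - u(x) equals s . grad u(x) up to O(|s|^2), except when x
lies within delta of a grid line, where the difference is only O(|s|).  So
  (u(x + s) - u(x)) (v(x + s) - v(x))
    = (s . grad u(x)) (s . grad v(x)) + O(|s|^3) + O(|s|^2) 1_kinks(x),
where the kink region has area O(delta) ([increment_mul_close]).

The kernel is normalised so that its matrix of second moments over the disc is
twice the identity ([integral_kernel_quad]).  For fixed x, integrating the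
leading term in s therefore gives 2 grad u(x) . grad v(x), and the error is
O(delta) + O(1) 1_kinks(x) ([inner_integral]).  Integrating in x gives
  |A_delta(u, v) - int grad u . grad v| = O(delta)   ([form_close]),
and the Dirichlet form of two tensor products of hats is a sum of products of
one-dimensional integrals ([integral_grad_mul]).

The moments come down to the total mass int |s|^2 rho, because the kernel is
invariant under exchanging the coordinates and under s_2 -> - s_2.  That mass
is computed in polar form: the map s -> |s|^2 sends planar Lebesgue measure to
pi times Lebesgue measure on the half line ([lebesgue_measure_sqnorm]), which
reflects that a disc of radius r has area pi r^2, and what remains is the
integral of a power, convergent at 0 exactly because alpha < 2. *)

(** * Area of the disc and integrals of radial functions *)

Section half_disc.
Context {R : realType}.
Notation leb := (@lebesgue_measure R).
Implicit Types r : R.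

(** The substitution x = r sin t turns the integrand into 2 r^2 cos^2 t, whose
primitive r^2 (t + sin t cos t) is smooth up to the end points; a primitive in
terms of asin would not be. *)
Lemma integral_sqrt_disc r : 0 < r ->
  (\int[leb]_(x in `[(- r)%R, r]) (2 * Num.sqrt (r ^+ 2 - x ^+ 2))%:E =
   (pi * r ^+ 2)%:E)%E.
Proof.
move=> r0.
pose a : R := - (pi / 2); pose b : R := pi / 2.
have ab : a < b by rewrite /a /b; have := pi_gt0 R; lra.
pose F : R -> R := fun t => r * sin t.
have dF (t : R) : is_derive t 1 F (r * cos t).
  by rewrite /F; apply: is_derive_eq.
have F'E : F^`()%classic = (fun t => r * cos t).
  by apply/funext => t; rewrite derive1E; apply: derive_val.
have F'c : continuous (fun t : R => r * cos t).
  by move=> t; apply: cvgMr; exact: continuous_cos.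
have Fc : continuous F by move=> t; apply: cvgMr; exact: continuous_sin.
have Fa : F a = - r by rewrite /F /a sinN sin_pihalf mulrN1.
have Fb : F b = r by rewrite /F /b sin_pihalf mulr1.
have Gc : continuous (fun x : R => 2 * Num.sqrt (r ^+ 2 - x ^+ 2)).
  move=> x; apply: cvgMr.
  apply: continuous_comp; last exact: sqrt_continuous.
  by apply: cvgB; [exact: cvg_cst|exact: exprn_continuous].
rewrite -{1}Fa -{1}Fb integration_by_substitution_increasing//; last 6 first.
- by move=> x y xab yab xy; rewrite /F ltr_pM2l// ltr_sin.
- by rewrite F'E => x _; exact: F'c.
- by rewrite F'E; apply/cvg_ex; exists (r * cos a); apply: cvg_at_right_filter; exact: F'c.
- by rewrite F'E; apply/cvg_ex; exists (r * cos b); apply: cvg_at_left_filter; exact: F'c.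
- split; last 2 first.
  + by apply: cvg_at_right_filter; exact: Fc.
  + by apply: cvg_at_left_filter; exact: Fc.
  by move=> x _; apply: ex_derive; exact: dF.
- by apply: continuous_subspaceT => x; exact: Gc.

(* a primitive of 2 r^2 cos^2 t *)
pose H : R -> R := fun t => r ^+ 2 * (t + sin t * cos t).
have dH (t : R) : is_derive t 1 H (r ^+ 2 * (1 + (sin t * - sin t + cos t * cos t))).
  by rewrite /H; apply: is_derive_eq.
have Hc : continuous H.
  by move=> t; apply/differentiable_continuous/derivable1_diffP/ex_derive; exact: dH.
rewrite (_ : (pi * r ^+ 2)%:E = ((H b)%:E - (H a)%:E)%E); last first.
  rewrite -EFinB /H /a /b sinN cosN cos_pihalf; congr EFin; lra.
apply: continuous_FTC2 => //.
- apply: continuous_subspaceT => x.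
  rewrite F'E; apply: cvgM; last exact: F'c.
  by apply: continuous_comp; [exact: Fc|exact: Gc].
- split; last 2 first.
  + by apply: cvg_at_right_filter; exact: Hc.
  + by apply: cvg_at_left_filter; exact: Hc.
  by move=> x _; apply: ex_derive; exact: dH.
- move=> x xab; rewrite derive1E (derive_val (is_derive := dH x)) F'E.
  have c0 : 0 < cos x by apply: cos_gt0_pihalf; move: xab; rewrite in_itv.
  have E : r ^+ 2 * (1 + (sin x * - sin x + cos x * cos x)) =
           2 * Num.sqrt (r ^+ 2 - (r * sin x) ^+ 2) * (r * cos x) :> R.
    rewrite [in RHS]exprMn -[X in X - _]mulr1 -mulrBr -(cos2Dsin2 x) addrK.
    rewrite -exprMn sqrtr_sqr ger0_norm ?mulr_ge0 ?ltW//.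
    by rewrite mulrN -expr2 sin2cos2; ring.
  exact: E.
- exact: ltW.
Qed.
End half_disc.

Section polar.
Context {R : realType}.
Notation leb := (@lebesgue_measure R).
Notation leb2 := (@lebesgue_measure R \x @lebesgue_measure R)%E.
Implicit Types r : R.

Definition sqnorm (s : R * R) : R := s.1 ^+ 2 + s.2 ^+ 2.

Lemma measurable_sqnorm : measurable_fun [set: R * R] sqnorm.
Proof. by apply: measurable_funD; apply: measurable_funX. Qed.

Lemma sqnorm_ge0 s : 0 <= sqnorm s.
Proof. by rewrite addr_ge0 ?sqr_ge0. Qed.

Lemma measurable_closed_disc c : measurable [set s : R * R | sqnorm s <= c].
Proof.
have := measurable_sqnorm measurableT _ (measurable_itv `]-oo, c]).
by rewrite setTI; congr measurable; apply/seteqP; split => s /=; rewrite in_itv.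
Qed.

(** Slicing by vertical lines: the section at abscissa x is an interval of
half-length sqrt(r^2 - x^2), and is empty when |x| > r. *)
Lemma area_disc r : 0 < r ->
  leb2 [set s : R * R | sqnorm s <= r ^+ 2] = (pi * r ^+ 2)%:E.
Proof.
move=> r0; rewrite -integral_sqrt_disc// [RHS]integral_mkcond /product_measure1.
apply: eq_integral => x _ /=.
have xsE : xsection [set s : R * R | sqnorm s <= r ^+ 2] x =
    [set y | x ^+ 2 + y ^+ 2 <= r ^+ 2].
  by apply/seteqP; split => y; rewrite /xsection /= inE.
rewrite xsE patchE; case: ifPn => [|xr].
  rewrite inE/= in_itv/= => xr.
  have d0 : 0 <= r ^+ 2 - x ^+ 2.
    by rewrite subr_sqr; move/andP: xr => [? ?]; apply: mulr_ge0; lra.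
  have -> : [set y | x ^+ 2 + y ^+ 2 <= r ^+ 2] =
      `[- Num.sqrt (r ^+ 2 - x ^+ 2), Num.sqrt (r ^+ 2 - x ^+ 2)]%classic.
    apply/seteqP; split => y /=; rewrite in_itv/= -ler_norml -sqrtr_sqr ler_sqrt//; lra.
  rewrite lebesgue_measure_itv/= lte_fin; set q := Num.sqrt _.
  have : 0 <= q by exact: sqrtr_ge0.
  rewrite le_eqVlt => /predU1P[<-|q0]; first by rewrite oppr0 ltxx mulr0.
  by rewrite gtrN// -EFinB opprK mulr_natl mulr2n.
have -> : [set y | x ^+ 2 + y ^+ 2 <= r ^+ 2] = set0; last by rewrite measure0.
apply/seteqP; split => y //= xyr; move: xr; rewrite notin_setE; apply => /=.
rewrite in_itv/= -ler_norml -(ger0_norm (ltW r0)) -!sqrtr_sqr ler_sqrt ?sqr_ge0//.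
by apply: le_trans xyr; rewrite lerDl sqr_ge0.
Qed.

Lemma area_disc0 : leb2 [set s : R * R | sqnorm s <= 0] = 0%E.
Proof.
have -> : [set s : R * R | sqnorm s <= 0] = [set 0] `*` [set 0].
  apply/seteqP; split => [[x y]|[x y]]/=; rewrite /sqnorm/=; last first.
    by move=> [-> ->]; rewrite expr0n/= addr0.
  move=> xy; have := sqr_ge0 x; have := sqr_ge0 y => y0 x0.
  by split; apply/eqP; rewrite -sqrf_eq0; apply/eqP; lra.
rewrite product_measure1E//= lebesgue_measure_set1 mul0e//.
Qed.

Lemma area_sqnorm c : 0 <= c ->
  leb2 [set s : R * R | sqnorm s <= c] = (pi * c)%:E.
Proof.
rewrite le_eqVlt => /predU1P[<-|c0]; first by rewrite area_disc0 mulr0.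
by rewrite -[c]sqr_sqrtr ?ltW// area_disc// sqrtr_gt0.
Qed.

Lemma area_annulus (a b : R) : 0 <= a -> a <= b ->
  leb2 (sqnorm @^-1` `]a, b]) = (pi * (b - a))%:E.
Proof.
move=> a0 ab.
have -> : sqnorm @^-1` `]a, b] =
    [set s : R * R | sqnorm s <= b] `\` [set s : R * R | sqnorm s <= a].
  apply/seteqP; split => s /=; rewrite in_itv/=.
    by move=> /andP[h1 h2]; split => //; apply/negP; rewrite -ltNge.
  by move=> [-> /negP]; rewrite -ltNge => ->.
rewrite measureD//=; [|exact: measurable_closed_disc..|].
  rewrite setIidr; last by move=> s /= /le_trans; apply.
  by rewrite !area_sqnorm ?(le_trans a0)// -EFinB -mulrBr.
by rewrite area_sqnorm ?(le_trans a0)// ltry.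
Qed.

(** The half line is completed to the whole line so that uniqueness of Lebesgue
measure applies: the push-forward of planar measure by the squared norm, divided
by pi, plus Lebesgue measure on the nonpositive numbers, gives every interval
]a, b] its length. *)
Lemma lebesgue_measure_sqnorm (A : set R) : measurable A ->
  A `<=` `]0, +oo[%classic ->
  leb2 (sqnorm @^-1` A) = (pi%:E * leb A)%E.
Proof.
move=> mA A0.
have pi0 : 0 <= pi^-1 :> R by rewrite invr_ge0 pi_ge0.
have m0 : measurable (`]-oo, 0%R]%classic : set (measurableTypeR R)) by exact: measurable_itv.
have [push pushE] : exists m : {measure set (measurableTypeR R) -> \bar R},
    forall B, m B = leb2 (sqnorm @^-1` B).
  unshelve eexists (pushforward leb2 (sqnorm : _ -> measurableTypeR R)).
    exact: measurable_sqnorm.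
  by [].
pose m := measure_add (mscale (NngNum pi0) push) (mrestr leb m0).
have mE B : m B = (pi^-1%:E * leb2 (sqnorm @^-1` B) + leb (B `&` `]-oo, 0%R]))%E.
  by rewrite -pushE /m measure_addE.
have -> : leb A = m A.
  apply: lebesgue_measure_unique mA => _ [[a b] _ <-] /=.
  transitivity (m `]a, b]%classic) => //; rewrite mE.
  have [ba|ab] := leP b a.
    by rewrite set_itv_ge ?bnd_simp -?leNgt// preimage_set0 set0I !measure0 mule0 adde0.
  have [a0|a0] := leP 0 a.
    rewrite area_annulus//; last exact: ltW.
    rewrite (_ : `]a, b] `&` `]-oo, 0%R] = set0); last first.
      by apply/seteqP; split => x //= []; rewrite !in_itv/=; lra.
    rewrite measure0 adde0 lebesgue_measure_itv/= lte_fin ab -EFinM mulKf//.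
    by rewrite gt_eqF// pi_gt0.
  rewrite (_ : sqnorm @^-1` `]a, b] = [set s : R * R | sqnorm s <= b]); last first.
    apply/seteqP; split => s /=; rewrite in_itv/=; first by move=> /andP[].
    by move=> ->; rewrite (lt_le_trans a0)// sqnorm_ge0.
  have [b0|b0] := leP 0 b.
    rewrite (_ : `]a, b] `&` `]-oo, 0%R] = `]a, 0%R]%classic); last first.
      by apply/seteqP; split => [x /= []|x /=]; rewrite !in_itv/=; [lra|split; lra].
    rewrite area_sqnorm// !lebesgue_measure_itv/= !lte_fin ab a0 -EFinM mulKf.
      by rewrite -!EFinD; congr EFin; lra.
    by rewrite gt_eqF// pi_gt0.
  rewrite (_ : `]a, b] `&` `]-oo, 0%R] = `]a, b]%classic); last first.
    by apply/seteqP; split => [x /= []|x /=]; rewrite !in_itv/=; [lra|split; lra].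
  rewrite (_ : [set s : R * R | sqnorm s <= b] = set0); last first.
    apply/seteqP; split => s //= /le_lt_trans/(_ b0).
    by rewrite ltNge sqnorm_ge0.
  by rewrite measure0 mule0 add0e.
rewrite mE (_ : A `&` _ = set0); last first.
  apply/seteqP; split => x //= [/A0/=]; rewrite !in_itv/=; lra.
rewrite measure0 adde0 muleA -EFinM divff ?mul1e//.
by rewrite gt_eqF// pi_gt0.
Qed.

Lemma integral_sqnorm (f : R -> \bar R) (D : set R) : measurable D ->
  D `<=` `]0, +oo[%classic -> measurable_fun D f ->
  (forall x, D x -> (0 <= f x)%E) ->
  (\int[leb2]_(s in sqnorm @^-1` D) f (sqnorm s) =
   pi%:E * \int[leb]_(x in D) f x)%E.
Proof.
move=> mD D0 mf f0; have pi0 : 0 <= pi :> R by exact: pi_ge0.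
rewrite -(ge0_integral_mscale _ _ (NngNum pi0))//.
have f0' : {in D, forall x, (0 <= f x)%E} by move=> x; rewrite inE; exact: f0.
have E := @ge0_integral_pushforward _ _ (measurableTypeR R * measurableTypeR R)%type
  (measurableTypeR R) R _ measurable_sqnorm leb2 D f mD mf f0'.
rewrite -[LHS]E; apply: eq_measure_integral => [|? A mA AD]; first exact: measurable_sqnorm.
exact: lebesgue_measure_sqnorm mA (subset_trans AD D0).
Qed.

(** The integrand may be unbounded at 0, so the fundamental theorem is applied
on [c / (n + 2), c] and n tends to infinity. *)
Lemma integral_powR_itv (p c : R) : -1 < p -> 0 < c ->
  (\int[leb]_(x in `]0%R, c[) (x `^ p)%:E = (c `^ (p + 1) / (p + 1))%:E)%E.
Proof.
move=> p1 c0; have q0 : 0 < p + 1 by lra.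
have mp (D : set R) : measurable_fun D (fun x : R => (x `^ p)%:E).
  by apply/measurable_EFinP; apply: measurable_funTS; exact: measurable_powR.
rewrite integral_itv_bndo_bndc//.
pose e (n : nat) : R := c / n.+2%:R.
have e0 n : 0 < e n by rewrite divr_gt0.
have ec n : e n < c by rewrite ltr_pdivrMr// ltr_pMr// ltr1n.
have e_cvg : e n @[n --> \oo] --> 0.
  have -> : 0 = c * 0 :> R by rewrite mulr0.
  by apply: cvgMr; have := @cvg_harmonic R; rewrite -cvg_shiftS.
have ->  : `]0, c]%classic = \bigcup_n `[e n, c]%classic.
  apply/seteqP; split => x /=; rewrite in_itv/=; last first.
    by move=> [n _]; rewrite /= !in_itv/= => /andP[/(lt_le_trans (e0 n)) -> ->].
  move=> /andP[x0 xc].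
  have [n _ /(_ n (leqnn n)) /= en] := cvgr0_norm_lt _ e_cvg _ x0.
  exists n => //=; rewrite in_itv/= xc andbT.
  by rewrite (le_trans (ler_norm _))// ltW.
have dF (x : R) : 0 < x -> is_derive x 1 (fun t : R => (p + 1)^-1 * t `^ (p + 1)) (x `^ p).
  move=> x0; have := is_derive1_powR (p + 1) x0; rewrite addrK => ?.
  by apply: is_derive_eq; rewrite /GRing.scale/= mulKf// gt_eqF.
have cF (x : R) : 0 < x -> {for x, continuous (fun t : R => (p + 1)^-1 * t `^ (p + 1))}.
  by move=> x0; apply/differentiable_continuous/derivable1_diffP/ex_derive; exact: dF.
have I n : (\int[leb]_(x in `[e n, c]) (x `^ p)%:E =
            (c `^ (p + 1) / (p + 1) - e n `^ (p + 1) / (p + 1))%:E)%E.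
  rewrite (@continuous_FTC2 _ (fun x => x `^ p) (fun t : R => (p + 1)^-1 * t `^ (p + 1)))//.
  - by rewrite -EFinB ![_ / (p + 1)]mulrC.
  - apply: continuous_in_subspaceT => x; rewrite inE/= in_itv/= => /andP[/(lt_le_trans (e0 n)) x0 _].
    apply/differentiable_continuous/derivable1_diffP/ex_derive; exact: is_derive1_powR.
  - split.
    + move=> x; rewrite in_itv/= => /andP[/(lt_trans (e0 n)) x0 _].
      by apply: ex_derive; exact: dF.
    + by apply: cvg_at_right_filter; exact: cF.
    + by apply: cvg_at_left_filter; exact: cF.
  - move=> x; rewrite in_itv/= => /andP[/(lt_trans (e0 n)) x0 _].
    by rewrite derive1E; have ? := dF _ x0; exact: derive_val.
have cv : (\int[leb]_(x in `[e n, c]) (x `^ p)%:E @[n --> \oo] -->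
           \int[leb]_(x in \bigcup_n `[e n, c]%classic) (x `^ p)%:E)%E.
  apply: ge0_nondecreasing_set_cvg_integral => //.
  - move=> n m nm; apply/subsetPset => x /=; rewrite !in_itv/= => /andP[ex ->].
    rewrite andbT (le_trans _ ex)// ler_pM2l// lef_pV2 ?posrE// ler_nat.
    by rewrite !ltnS.
  - by move=> n; exact: mp.
  - by move=> n x _; rewrite lee_fin powR_ge0.
have cv2 : (\int[leb]_(x in `[e n, c]) (x `^ p)%:E @[n --> \oo] -->
            (c `^ (p + 1) / (p + 1))%:E)%E.
  rewrite (eq_cvg _ _ I); apply: cvg_EFin; first exact: nearW.
  rewrite -[X in _ --> X]subr0 -[X in _ - X](mul0r (p + 1)^-1).
  apply: cvgB; first exact: cvg_cst.
  by apply: cvgMl; exact: (cvg_at_rightP _ 0 0).1 (powR_cvg0 q0) e (conj e0 e_cvg).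
exact: (cvg_unique _ cv cv2).
Qed.
End polar.

(** * Second moments of the kernel *)

Section moments.
Context {R : realType}.
Notation leb := (@lebesgue_measure R).
Notation leb2 := (@lebesgue_measure R \x @lebesgue_measure R)%E.
Local Open Scope ereal_scope.

Lemma ge0_integral_swap (f : R * R -> \bar R) : measurable_fun setT f ->
  (forall s, 0 <= f s) ->
  \int[leb2]_s f (s.2, s.1) = \int[leb2]_s f s.
Proof.
move=> mf f0.
have mg : measurable_fun [set: R * R] (fun s : R * R => f (s.2, s.1)).
  by apply: measurableT_comp mf _; exact: measurable_swap.
rewrite [RHS](@fubini_tonelli1 _ _ _ _ _ leb leb f mf f0).
exact: (@fubini_tonelli2 _ _ _ _ _ leb leb (fun s => f (s.2, s.1)) mg (fun s => f0 _)).
Qed.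

Lemma ge0_integralN (f : R -> \bar R) : measurable_fun setT f ->
  (forall x, 0 <= f x) -> \int[leb]_x f (- x)%R = \int[leb]_x f x.
Proof.
move=> mf f0.
have mN : measurable_fun [set: measurableTypeR R] (-%R : _ -> measurableTypeR R).
  exact: oppr_measurable.
have E := ge0_integral_pushforward mN leb measurableT mf (fun x _ => f0 x).
rewrite preimage_setT in E; rewrite -[LHS]E.
by apply: eq_measure_integral => A mA _; exact: lebesgue_measureN.
Qed.

Lemma ge0_integral_reflect (f : R * R -> \bar R) : measurable_fun setT f ->
  (forall s, 0 <= f s) ->
  \int[leb2]_s f (s.1, - s.2)%R = \int[leb2]_s f s.
Proof.
move=> mf f0.
have mg : measurable_fun [set: R * R] (fun s : R * R => f (s.1, - s.2)%R).
  apply: measurableT_comp mf _; apply/measurable_fun_pairP; split; first exact: measurable_fst.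
  by apply: (measurableT_comp (f := (-%R : R -> R))); [exact: oppr_measurable|exact: measurable_snd].
rewrite [RHS](@fubini_tonelli1 _ _ _ _ _ leb leb f mf f0).
rewrite [LHS](@fubini_tonelli1 _ _ _ _ _ leb leb (fun s => f (s.1, - s.2)%R) mg (fun s => f0 _)).
apply: eq_integral => x _; apply: ge0_integralN => [|y]; last exact: f0.
by apply: measurableT_comp mf _; exact: measurable_pair1.
Qed.

(** Integrability makes the positive and negative parts, which the reflection
exchanges, have the same finite integral. *)
Lemma integral_odd (f : R * R -> R) :
  leb2.-integrable setT (EFin \o f) ->
  (forall s, f (s.1, - s.2) = - f s)%R ->
  \int[leb2]_s (f s)%:E = 0.
Proof.
move=> fi fodd; rewrite integralE.
have mp : measurable_fun [set: R * R] (EFin \o f)^\+.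
  by apply: measurable_funepos; exact: measurable_int fi.
have -> : \int[leb2]_s (EFin \o f)^\- s = \int[leb2]_s (EFin \o f)^\+ s.
  rewrite -(ge0_integral_reflect _ mp)//; apply: eq_integral => s _.
  by rewrite funenegE funeposE /= fodd.
by rewrite subee//; exact: integrable_pos_fin_num.
Qed.

Section symmetric_weight.
Variables (w : R * R -> R) (m : R).
Hypotheses (mw : measurable_fun setT w) (w0 : forall s, (0 <= w s)%R).
Hypothesis wswap : forall s, w (s.2, s.1) = w s.
Hypothesis wreflect : forall s, w (s.1, - s.2)%R = w s.
Hypothesis wm : \int[leb2]_s (sqnorm s * w s)%:E = m%:E.

Let quad a b c (s : R * R) : R :=
  ((a * s.1 ^+ 2 + b * (s.1 * s.2) + c * s.2 ^+ 2) * w s)%R.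

Let mquad a b c : measurable_fun [set: R * R] (quad a b c).
Proof.
apply: measurable_funM mw; apply: measurable_funD.
  apply: measurable_funD; apply: measurable_funM => //.
    by apply: measurable_funX; exact: measurable_fst.
  by apply: measurable_funM; [exact: measurable_fst|exact: measurable_snd].
by apply: measurable_funM => //; apply: measurable_funX; exact: measurable_snd.
Qed.

Lemma integrable_sqnorm_weight :
  leb2.-integrable setT (fun s => (sqnorm s * w s)%:E).
Proof.
apply/integrableP; split.
  by apply/measurable_EFinP; apply: measurable_funM mw; exact: measurable_sqnorm.
under eq_integral do rewrite gee0_abs ?lee_fin ?mulr_ge0 ?sqnorm_ge0//.
by rewrite wm ltry.
Qed.

Lemma integrable_quad a b c :
  leb2.-integrable setT (fun s => (quad a b c s)%:E).
Proof.
have := integrableZl measurableT (`|a| + `|b| + `|c|)%R integrable_sqnorm_weight.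
apply: le_integrable => //; first by apply/measurable_EFinP; exact: mquad.
move=> [x y] _; rewrite /quad /sqnorm /= lee_fin !normrM [leRHS]mulrA.
rewrite ler_wpM2r//.
have -> : (`| `|a| + `|b| + `|c| | = `|a| + `|b| + `|c|)%R by rewrite ger0_norm ?addr_ge0.
have -> : (`|x ^+ 2 + y ^+ 2| = x ^+ 2 + y ^+ 2)%R by rewrite ger0_norm ?addr_ge0 ?sqr_ge0.
have xy : (`|x * y| <= x ^+ 2 + y ^+ 2)%R.
  have := sqr_ge0 (x - y)%R; have := sqr_ge0 (x + y)%R.
  have := sqr_ge0 x; have := sqr_ge0 y.
  by rewrite sqrrB sqrrD ler_norml => *; apply/andP; split; lra.
rewrite (le_trans (ler_normD _ _))// mulrDl lerD//.
  rewrite (le_trans (ler_normD _ _))// mulrDl lerD// normrM ler_wpM2l//.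
  by rewrite ger0_norm ?sqr_ge0// lerDl sqr_ge0.
by rewrite normrM ler_wpM2l// ger0_norm ?sqr_ge0// lerDr sqr_ge0.
Qed.

(** The cross term is odd in s_2, and the two pure squares have equal integrals
by symmetry, so each of them carries half of the total mass m. *)
Lemma integral_quad a b c :
  \int[leb2]_s (quad a b c s)%:E = ((a + c) * (m / 2))%:E.
Proof.
have odd : \int[leb2]_s (quad 0 1 0 s)%:E = 0.
  apply: integral_odd; first exact: integrable_quad.
  by move=> s; rewrite /quad /= wreflect; ring.
have swap : \int[leb2]_s (quad 0 0 1 s)%:E = \int[leb2]_s (quad 1 0 0 s)%:E.
  rewrite -(ge0_integral_swap (fun s => (quad 1 0 0 s)%:E)).
  - by apply: eq_integral => s _; rewrite /quad /= wswap; congr EFin; ring.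
  - by apply/measurable_EFinP; exact: mquad.
  - by move=> s; rewrite lee_fin /quad !mul0r !addr0 mul1r mulr_ge0 ?sqr_ge0.
have [q1 qE] : exists q1, \int[leb2]_s (quad 1 0 0 s)%:E = q1%:E.
  have := integrable_fin_num measurableT (integrable_quad 1 0 0).
  by move/fineK => <-; eexists.
have sum : (q1 + q1)%:E = m%:E.
  rewrite EFinD -{1}qE -qE -{2}swap -integralD//=; try exact: integrable_quad.
  by rewrite -wm; apply: eq_integral => s _; rewrite /quad /sqnorm -EFinD; congr EFin; ring.
have -> : \int[leb2]_s (quad a b c s)%:E =
    \int[leb2]_s (a%:E * (quad 1 0 0 s)%:E + b%:E * (quad 0 1 0 s)%:E + c%:E * (quad 0 0 1 s)%:E).
  by apply: eq_integral => s _; rewrite /quad -!EFinM -!EFinD; congr EFin; ring.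
rewrite !integralD//=; try by do ?apply: integrableD => //; apply: integrableZl => //; exact: integrable_quad.
rewrite !integralZl//; try exact: integrable_quad.
rewrite odd swap qE mule0 adde0 -!EFinM -EFinD; congr EFin.
by case: sum => <-; field.
Qed.

End symmetric_weight.
End moments.

Section kernel_weight.
Context {R : realType}.
Notation leb := (@lebesgue_measure R).
Notation leb2 := (@lebesgue_measure R \x @lebesgue_measure R)%E.
Variables alpha delta : R.
Hypothesis delta0 : 0 < delta.
Hypothesis alpha2 : alpha < 2.

Definition kernel_weight (s : R * R) : R :=
  rho alpha delta (enorm2 s) * \1_(disc delta) s.

Lemma measurable_enorm2 : measurable_fun setT (@enorm2 R).
Proof.
exact: measurableT_comp (continuous_measurable_fun (@sqrt_continuous R))
  measurable_sqnorm.
Qed.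

Lemma measurable_disc : measurable (disc delta : set (R * R)).
Proof.
have := measurable_enorm2 measurableT _ (measurable_itv `]-oo, delta[).
by rewrite setTI; congr measurable; apply/seteqP; split => s /=; rewrite in_itv.
Qed.

Lemma measurable_kernel_weight : measurable_fun setT kernel_weight.
Proof.
apply: measurable_funM; last by apply: measurable_indic; exact: measurable_disc.
rewrite /rho; apply: measurable_funM => //.
under eq_fun do rewrite -powRN.
exact: measurableT_comp (measurable_powR _) measurable_enorm2.
Qed.

Lemma kernel_weight_ge0 s : 0 <= kernel_weight s.
Proof.
rewrite /kernel_weight indicE mulr_ge0//.
by rewrite /rho !mulr_ge0// ?invr_ge0 ?powR_ge0 ?pi_ge0// subr_ge0 ltW.
Qed.

Lemma disc_sqnorm (s : R * R) : (s \in disc delta) = (sqnorm s < delta ^+ 2).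
Proof.
apply/idP/idP; rewrite inE /disc/= /enorm2 -/(sqnorm s).
  by rewrite -[X in _ < X]ger0_norm ?ltW// -sqrtr_sqr ltr_sqrt// exprn_gt0.
by move=> h; rewrite -[X in _ < X]ger0_norm ?ltW// -sqrtr_sqr ltr_sqrt// exprn_gt0.
Qed.

Lemma sqnorm_kernel_weight (s : R * R) : 0 < sqnorm s ->
  sqnorm s * rho alpha delta (enorm2 s) =
  2 * (2 - alpha) / pi * delta `^ (alpha - 2) * sqnorm s `^ (- (alpha / 2)).
Proof.
move=> s0; rewrite /rho /enorm2 -/(sqnorm s) -powR12_sqrt ?ltW//.
rewrite -powRrM -powRN mulrCA; congr (_ * _).
rewrite -{1}[sqnorm s]powRr1 ?ltW// -powRD; last by rewrite (gt_eqF s0) implybT.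
by congr (_ `^ _); field.
Qed.

(** In terms of t = |s|^2 the integrand is K t^(- alpha / 2) on 0 < t < delta^2,
and pi K int t^(- alpha / 2) dt = 4.  The origin, where rho takes a default
value, contributes nothing because of the factor |s|^2. *)
Lemma integral_sqnorm_kernel_weight :
  (\int[leb2]_s (sqnorm s * kernel_weight s)%:E = 4%:E)%E.
Proof.
pose K := 2 * (2 - alpha) / pi * delta `^ (alpha - 2).
have K0 : 0 <= K.
  by rewrite !mulr_ge0 ?invr_ge0 ?powR_ge0 ?pi_ge0 ?subr_ge0 ?ltW.
have d2 : 0 < delta ^+ 2 by rewrite exprn_gt0.
transitivity (\int[leb2]_(s in sqnorm @^-1` `]0%R, (delta ^+ 2)%R[)
    (K * sqnorm s `^ (- (alpha / 2)))%:E)%E.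
  rewrite [RHS]integral_mkcond; apply: eq_integral => s _.
  have E : (s \in sqnorm @^-1` `]0%R, (delta ^+ 2)%R[) = (0 < sqnorm s < delta ^+ 2).
    by apply/idP/idP; rewrite inE /= in_itv.
  rewrite patchE E /kernel_weight indicE disc_sqnorm.
  have := sqnorm_ge0 s; rewrite le_eqVlt => /predU1P[<-|s0].
    by rewrite ltxx mul0r.
  rewrite s0/=; case: ifPn => _; last by rewrite !mulr0.
  by rewrite mulr1 sqnorm_kernel_weight.
rewrite (integral_sqnorm (fun t => (K * t `^ (- (alpha / 2)))%:E))//; last 3 first.
- by apply: subset_itvl; rewrite bnd_simp.
- apply/measurable_EFinP; apply: measurable_funM => //.
  by apply: measurable_funTS; exact: measurable_powR.
- by move=> x _; rewrite lee_fin mulr_ge0// powR_ge0.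
under eq_integral do rewrite EFinM.
rewrite ge0_integralZl_EFin//; last 2 first.
- by move=> x _; rewrite lee_fin powR_ge0.
- by apply/measurable_EFinP; apply: measurable_funTS; exact: measurable_powR.
rewrite integral_powR_itv//; last by have := alpha2; lra.
rewrite -!EFinM; congr EFin.
have -> : (delta ^+ 2) `^ (- (alpha / 2) + 1) = (delta `^ (alpha - 2))^-1.
  by rewrite -powR_mulrn ?ltW// -powRrM -powRN; congr (_ `^ _); lra.
have p0 : (pi : R) != 0 by rewrite gt_eqF// pi_gt0.
have q0 : delta `^ (alpha - 2) != 0 by rewrite gt_eqF// powR_gt0.
rewrite /K; move: (pi : R) p0 (delta `^ _) q0 => P p0 Q q0.
by field; rewrite p0 q0 !andbT; have := alpha2; lra.
Qed.

Lemma integrable_kernel_quad (a b c : R) : leb2.-integrable setT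
  (fun s => ((a * s.1 ^+ 2 + b * (s.1 * s.2) + c * s.2 ^+ 2) * kernel_weight s)%:E).
Proof.
exact: integrable_quad measurable_kernel_weight kernel_weight_ge0
  integral_sqnorm_kernel_weight _ _ _.
Qed.

Lemma kernel_weight_swap (s : R * R) : kernel_weight (s.2, s.1) = kernel_weight s.
Proof. by rewrite /kernel_weight /enorm2 !indicE !disc_sqnorm /sqnorm/= addrC. Qed.

Lemma kernel_weight_reflect (s : R * R) : kernel_weight (s.1, - s.2) = kernel_weight s.
Proof. by rewrite /kernel_weight /enorm2 !indicE !disc_sqnorm /sqnorm/= sqrrN. Qed.

Lemma integral_kernel_quad (a b c : R) : (\int[leb2]_s
  ((a * s.1 ^+ 2 + b * (s.1 * s.2) + c * s.2 ^+ 2) * kernel_weight s)%:E =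
  (2 * (a + c))%:E)%E.
Proof.
rewrite (integral_quad _ 4 measurable_kernel_weight kernel_weight_ge0
  kernel_weight_swap kernel_weight_reflect integral_sqnorm_kernel_weight).
by congr EFin; field.
Qed.
End kernel_weight.

(** * Increments of hat functions *)

Section tent.
Context {R : realType}.
Implicit Types z w e : R.

(** The hat function in the coordinate centred at its node and scaled by the
mesh size. *)
Definition tent z : R :=
  if -1 < z <= 0 then z + 1 else if 0 < z < 1 then 1 - z else 0.

(** The one-sided values chosen at -1, 0 and 1 make the slope a combination of
indicators of the half-open cells ]k, k + 1]. *)
Definition tent_slope z : R :=
  if -1 < z <= 0 then 1 else if 0 < z <= 1 then - 1 else 0.

Variant tent_spec z : R -> R -> Prop :=
| TentLeft of z <= -1 : tent_spec z 0 0
| TentUp of -1 < z & z <= 0 : tent_spec z (z + 1) 1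
| TentDown of 0 < z & z <= 1 : tent_spec z (1 - z) (-1)
| TentRight of 1 < z : tent_spec z 0 0.

Lemma tentP z : tent_spec z (tent z) (tent_slope z).
Proof.
rewrite /tent /tent_slope.
have [z0|z0] := ltP (-1) z; have [z1|z1] := lerP z 0; rewrite /=.
- exact: TentUp.
- have [z2|z2|z2] := ltrgtP z 1.
  + by apply: TentDown => //; exact: ltW.
  + exact: TentRight.
  + have -> : 0 = 1 - z by rewrite z2 subrr.
    by apply: TentDown; rewrite ?z2.
- exact: TentLeft.
- lra.
Qed.

Lemma tent_ge0_le1 z : 0 <= tent z <= 1.
Proof. by case: tentP => *; apply/andP; split; lra. Qed.

Lemma tent_slope_le1 z : `|tent_slope z| <= 1.
Proof. by case: tentP => *; rewrite ?normrN ?normr1 ?normr0. Qed.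

Lemma tent_lipschitz z w : `|tent z - tent w| <= `|z - w|.
Proof.
rewrite ler_norml; case: (tentP z) => *; case: (tentP w) => *;
  case: (ger0P (z - w)) => *; apply/andP; split; lra.
Qed.

(** If no kink -1, 0, 1 lies within e of z, then z and z + w are in the same
piece. *)
Lemma tent_affine e z w : e < 1 -> `|w| <= e ->
  e < `|z - (- 1)| -> e < `|z| -> e < `|z - 1| ->
  tent (z + w) - tent z = w * tent_slope z.
Proof.
rewrite ler_norml !ltr_normr => e1 /andP[we1 we2] /orP[h1|h1] /orP[h2|h2] /orP[h3|h3];
  case: (tentP z) => *; case: (tentP (z + w)) => *; lra.
Qed.

End tent.

Section hat.
Context {R : realType}.
Variables a h : R.
Hypothesis h0 : 0 < h.
Implicit Types (n : nat) (x t e : R).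

Lemma nodeS n : node a h n.+1 = node a h n + h.
Proof. by rewrite /node -[n.+1]addn1 natrD mulrDl mul1r addrA. Qed.

Lemma hatE n x : hat a h n.+1 x = tent ((x - node a h n.+1) / h).
Proof.
pose z := (x - node a h n.+1) / h; rewrite -/z.
have -> : x = node a h n.+1 + z * h by rewrite /z divfK ?gt_eqF// addrC subrK.
rewrite /hat /= [node a h n.+2]nodeS; set c := node a h n.+1.
have -> : node a h n = c - h by rewrite /c nodeS addrK.
rewrite ltrD2l -[- h]mulN1r ltr_pM2r// gerDl pmulr_lle0// ltrDl pmulr_lgt0//.
rewrite ltrD2l gtr_pMl// /tent; case: ifP => _.
  by field; exact: lt0r_neq0.
case: ifP => _ //.
by field; exact: lt0r_neq0.
Qed.

Definition cell n : set R := `]node a h n, node a h n.+1].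

(** The almost everywhere derivative of the hat at node n. *)
Definition hat_slope n x : R := h^-1 * (\1_(cell n.-1) x - \1_(cell n) x).

Lemma in_cell n x : (x \in cell n) = (node a h n < x <= node a h n.+1).
Proof. by apply/idP/idP; rewrite inE /cell /= in_itv. Qed.

Lemma hat_slopeE n x :
  hat_slope n.+1 x = h^-1 * tent_slope ((x - node a h n.+1) / h).
Proof.
congr (_ * _); rewrite !indicE !in_cell /=.
pose z := (x - node a h n.+1) / h; rewrite -/z.
have -> : x = node a h n.+1 + z * h by rewrite /z divfK ?gt_eqF// addrC subrK.
rewrite /hat /= [node a h n.+2]nodeS; set c := node a h n.+1.
have -> : node a h n = c - h by rewrite /c nodeS addrK.
rewrite ltrD2l -[- h]mulN1r ltr_pM2r// gerDl pmulr_lle0// ltrDl pmulr_lgt0//.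
rewrite lerD2l ger_pMl// /tent_slope.
have [z0|z0] := lerP z 0; rewrite /= ?andbT ?andbF ?subr0.
  by case: ifP.
by rewrite (_ : false%:R = 0)// sub0r; case: (z <= 1) => //=; rewrite oppr0.
Qed.

Lemma hat_ge0_le1 n x : 0 <= hat a h n.+1 x <= 1.
Proof. by rewrite hatE tent_ge0_le1. Qed.

Lemma hat_lipschitz n x t : `|hat a h n.+1 (x + t) - hat a h n.+1 x| <= h^-1 * `|t|.
Proof.
rewrite !hatE; apply: le_trans (tent_lipschitz _ _) _; rewrite -mulrBl.
have -> : x + t - node a h n.+1 - (x - node a h n.+1) = t by ring.
by rewrite normrM [`|h^-1|]gtr0_norm ?invr_gt0// mulrC.
Qed.

Lemma hat_slope_le n x : `|hat_slope n.+1 x| <= h^-1.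
Proof.
rewrite hat_slopeE normrM gtr0_norm ?invr_gt0// ler_piMr ?tent_slope_le1// invr_ge0.
exact: ltW.
Qed.

(** The number of kinks of the hat at node n within e of x.  It majorises the
indicator of the exceptional set and is a sum of three indicators, so that its
integral is 6 e. *)
Definition kinks e n x : R :=
  \sum_(k < 3) \1_`[node a h (n.-1 + k) - e, node a h (n.-1 + k) + e] x.

Lemma kinks_ge0 e n x : 0 <= kinks e n x.
Proof. by apply: sumr_ge0 => k _; rewrite indicE. Qed.

Lemma hat_affine e n x t : e < h -> `|t| <= e -> kinks e n.+1 x < 1 ->
  hat a h n.+1 (x + t) - hat a h n.+1 x = t * hat_slope n.+1 x.
Proof.
move=> eh te k1.
have far (k : 'I_3) : e < `|x - node a h (n + k)|.
  move: k1; rewrite ltNge => k1; rewrite ltNge; apply: contra k1 => xk.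
  rewrite /kinks (bigD1 k)//= indicE mem_set/=; last first.
    by rewrite in_itv/= -ler_distl.
  by rewrite lerDl sumr_ge0// => j _; rewrite indicE.
have scale c : `|(x - c) / h| = `|x - c| / h.
  by rewrite normrM [`|h^-1|]gtr0_norm ?invr_gt0.
rewrite !hatE hat_slopeE mulrCA.
have -> : (x + t - node a h n.+1) / h = (x - node a h n.+1) / h + t / h.
  by rewrite -mulrDl addrAC.
rewrite (@tent_affine _ (e / h)).
- by rewrite mulrA [t / h * _]mulrC [h^-1 * _]mulrC mulrC.
- by rewrite ltr_pdivrMr// mul1r.
- by rewrite normrM [`|h^-1|]gtr0_norm ?invr_gt0// ler_pM2r ?invr_gt0.
- have := far 0; rewrite addn0 -(ltr_pM2r (x := h^-1)) ?invr_gt0// -scale.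
  by rewrite nodeS; congr (_ < `|_|); field; exact: lt0r_neq0.
- by have := far 1; rewrite addn1 -(ltr_pM2r (x := h^-1)) ?invr_gt0// -scale.
- have := far 2%:R; rewrite addn2 nodeS -(ltr_pM2r (x := h^-1)) ?invr_gt0// -scale.
  by congr (_ < `|_|); field; exact: lt0r_neq0.
Qed.

(** Near a kink both terms are bounded separately by |t| / h; elsewhere the
difference vanishes. *)
Lemma hat_increment e n x t : e < h -> `|t| <= e ->
  `|hat a h n.+1 (x + t) - hat a h n.+1 x - t * hat_slope n.+1 x|
    <= 2 * h^-1 * `|t| * kinks e n.+1 x.
Proof.
move=> eh te; have [k1|k1] := ltP (kinks e n.+1 x) 1.
  rewrite (hat_affine e)// subrr normr0.
  by rewrite !mulr_ge0 ?invr_ge0 ?kinks_ge0// ltW.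
have C0 : 0 <= 2 * h^-1 * `|t| by rewrite !mulr_ge0 ?invr_ge0// ltW.
apply: le_trans (ler_wpM2l C0 k1).
rewrite mulr1 (le_trans (ler_normB _ _))// -mulrA mulr_natl mulr2n.
rewrite lerD ?hat_lipschitz// normrM mulrC ler_wpM2r//.
exact: hat_slope_le.
Qed.

End hat.

(** * Integrals of products of hat functions *)

Section has_integral.
Context {d} {T : measurableType d} {R : realType}.
Variable mu : {measure set T -> \bar R}.
Implicit Types (f g : T -> R) (v w c : R).

(** Integrability and value in one statement, stable under linear combinations
and tensor products. *)
Definition has_integral f v : Prop :=
  mu.-integrable setT (EFin \o f) /\ (\int[mu]_x (f x)%:E = v%:E)%E.

(** A real-valued measurable function whose integral is a real number is
integrable: were the integral of its positive or of its negative part infinite,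
their difference would be infinite too, +oo - +oo being -oo by convention. *)
Lemma has_integralP f v : measurable_fun setT f ->
  (\int[mu]_x (f x)%:E = v%:E)%E -> has_integral f v.
Proof.
move=> mf fv; split=> //; apply/integrableP; split; first exact/measurable_EFinP.
by rewrite integral_fin_num_abs// fv.
Qed.

Lemma has_integralD f g v w : has_integral f v -> has_integral g w ->
  has_integral (fun x => f x + g x) (v + w).
Proof.
move=> [fi fv] [gi gw]; split; first exact: (integrableD measurableT fi gi).
by under eq_integral do rewrite EFinD; rewrite (integralD measurableT fi gi) fv gw.
Qed.

Lemma has_integralZ c f v : has_integral f v ->
  has_integral (fun x => c * f x) (c * v).
Proof.
move=> [fi fv]; split; first exact: (integrableZl measurableT c fi).
by under eq_integral do rewrite EFinM; rewrite (integralZl measurableT fi) fv.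
Qed.

End has_integral.

Section tensor.
Context {R : realType}.
Notation leb := (@lebesgue_measure R).
Notation leb2 := (@lebesgue_measure R \x @lebesgue_measure R)%E.

Lemma has_integral_tensor (f g : R -> R) (v w : R) :
  has_integral leb f v -> has_integral leb g w ->
  has_integral leb2 (fun x => f x.1 * g x.2) (v * w).
Proof.
move=> [fi fv] [gi gw].
have mf : measurable_fun setT f by apply/measurable_EFinP; exact: measurable_int fi.
have mg : measurable_fun setT g by apply/measurable_EFinP; exact: measurable_int gi.
have mfg : measurable_fun [set: R * R] (fun x : R * R => (f x.1 * g x.2)%:E).
  apply/measurable_EFinP; apply: measurable_funM.
    exact: measurableT_comp mf measurable_fst.
  exact: measurableT_comp mg measurable_snd.
have [/integrableP[_ foo] /integrableP[_ goo]] := (fi, gi).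
have fgi : leb2.-integrable setT (fun x => (f x.1 * g x.2)%:E).
  apply/(@integrable12ltyP _ _ _ _ _ leb leb _ mfg).
  have E x : (\int[leb]_y `|(f x * g y)%:E| =
      `|(f x)%:E| * \int[leb]_y `|(g y)%:E|)%E.
    under eq_integral do rewrite EFinM abseM.
    rewrite ge0_integralZl//; first exact/measurableT_comp/measurable_EFinP.
  under eq_integral do rewrite E.
  rewrite ge0_integralZr//; last 2 first.
  - exact/measurableT_comp/measurable_EFinP.
  - exact: integral_ge0.
  have f0 : (0 <= \int[leb]_x `|(f x)%:E|)%E by exact: integral_ge0.
  by apply: lte_mul_pinfty => //; rewrite ge0_fin_numE.
split => //; rewrite -(@integral12_prod_meas1 _ _ _ _ _ leb leb _ fgi) /fubini_F /=.
under eq_integral do (under eq_integral do rewrite EFinM; rewrite (integralZl measurableT gi)).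
by rewrite gw (integralZr measurableT fi) fv.
Qed.

End tensor.

Section hat_integrals.
Context {R : realType}.
Notation leb := (@lebesgue_measure R).
Variables a h : R.
Hypothesis h0 : 0 < h.
Implicit Types (n k l : nat) (x c : R).

Definition local_coord n x : R := (x - node a h n) / h.

Lemma measurable_local_coord n : measurable_fun setT (local_coord n).
Proof. by apply: measurable_funM => //; exact: measurable_funB. Qed.

Lemma measurable_cell n : measurable (cell a h n).
Proof. exact: measurable_itv. Qed.

Lemma hat_cells n x : hat a h n.+1 x =
  \1_(cell a h n) x * local_coord n x
  + \1_(cell a h n.+1) x * (1 - local_coord n.+1 x).
Proof.
rewrite !indicE !in_cell /hat /local_coord /=; case: ifPn => [/andP[xl xr]|xN].
  by rewrite ltNge xr/= mul0r addr0 mul1r.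
rewrite mul0r add0r; have [xl|xl] := ltP _ x; last by rewrite mul0r.
rewrite nodeS; have [xr|xr|->] := ltrgtP x (node a h n.+1 + h); rewrite ?mul0r//= mul1r.
  by field; exact: lt0r_neq0.
by field; exact: lt0r_neq0.
Qed.

Lemma measurable_hat n : measurable_fun setT (hat a h n.+1).
Proof.
rewrite (_ : hat a h n.+1 = fun x => \1_(cell a h n) x * local_coord n x
  + \1_(cell a h n.+1) x * (1 - local_coord n.+1 x)); last first.
  by apply/funext => x; exact: hat_cells.
apply: measurable_funD; apply: measurable_funM; try by apply: measurable_indic; exact: measurable_cell.
  exact: measurable_local_coord.
by apply: measurable_funB => //; exact: measurable_local_coord.
Qed.

Definition cell_quad n c0 c1 c2 x : R :=
  \1_(cell a h n) x * (c0 + c1 * local_coord n x + c2 * local_coord n x ^+ 2).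

Lemma measurable_cell_quad n c0 c1 c2 : measurable_fun setT (cell_quad n c0 c1 c2).
Proof.
apply: measurable_funM; first by apply: measurable_indic; exact: measurable_cell.
have mu := measurable_local_coord n.
apply: measurable_funD; last by apply: measurable_funM => //; exact: measurable_funX.
by apply: measurable_funD => //; exact: measurable_funM.
Qed.

Lemma integral_cell_quad n c0 c1 c2 :
  has_integral leb (cell_quad n c0 c1 c2) (h * (c0 + c1 / 2 + c2 / 3)).
Proof.
apply: has_integralP; first exact: measurable_cell_quad.
pose q x := c0 + c1 * local_coord n x + c2 * local_coord n x ^+ 2.
pose F x := h * (c0 * local_coord n x + c1 / 2 * local_coord n x ^+ 2
                 + c2 / 3 * local_coord n x ^+ 3).
have hn0 : h != 0 by exact: lt0r_neq0.
have du x : is_derive x (1 : R) (local_coord n) h^-1.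
  rewrite /local_coord; apply: is_derive_eq.
  by rewrite /GRing.scale/= mulr0 add0r subr0 mulr1.
have dF x : is_derive x (1 : R) F (q x).
  have ? := du x; rewrite /F; apply: is_derive_eq.
  by rewrite /q /GRing.scale/=; field.
have cq : continuous q.
  have cu : continuous (local_coord n).
    by move=> x; apply/differentiable_continuous/derivable1_diffP/ex_derive; exact: du.
  move=> x; apply: cvgD; first apply: cvgD; first exact: cvg_cst.
    by apply: cvgMr; exact: cu.
  apply: cvgMr; apply: (@continuous_comp _ _ _ (local_coord n) (fun u => u ^+ 2)).
    exact: cu.
  exact: exprn_continuous.
have cF : continuous F.
  by move=> x; apply/differentiable_continuous/derivable1_diffP/ex_derive; exact: dF.
have ? : node a h n < node a h n.+1 by rewrite nodeS ltrDl.
transitivity (\int[leb]_(x in cell a h n) (q x)%:E)%E.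
  rewrite [RHS]integral_mkcond; apply: eq_integral => x _.
  by rewrite patchE /cell_quad indicE; case: ifP => _; rewrite ?mul1r ?mul0r.
rewrite /cell integral_itv_obnd_cbnd; last first.
  apply/measurable_EFinP; apply: measurable_funTS.
  exact: continuous_measurable_fun.
rewrite (@continuous_FTC2 _ q F)//.
- rewrite -EFinB; congr EFin; by rewrite /F /local_coord nodeS; field.
- exact: continuous_subspaceT.
- split => [x _||].
  + by apply: ex_derive; exact: dF.
  + by apply: cvg_at_right_filter; exact: cF.
  + by apply: cvg_at_left_filter; exact: cF.
- by move=> x _; rewrite derive1E; have ? := dF x; exact: derive_val.
Qed.

(** Distinct cells are disjoint. *)
Lemma indic_cellM k l x :
  \1_(cell a h k) x * \1_(cell a h l) x = (k == l)%:R * \1_(cell a h k) x :> R.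
Proof.
have disj m p : (m < p)%N -> x \in cell a h m -> x \notin cell a h p.
  rewrite !in_cell => mp /andP[_ xm]; rewrite negb_and -leNgt; apply/orP; left.
  apply: le_trans xm _; rewrite /node lerD2l ler_pM2r// ler_nat.
  exact: mp.
rewrite !indicE; have [kl|lk|->] := ltngtP k l; last first.
- by case: (x \in _); rewrite ?mul1r ?mulr0.
- by have [/(disj _ _ lk)/negbTE ->|_] := boolP (x \in cell a h l); rewrite !mul0r ?mulr0.
- by have [/(disj _ _ kl)/negbTE ->|_] := boolP (x \in cell a h k); rewrite ?mul0r ?mulr0.
Qed.

Lemma integral_hat_mul i j : has_integral leb
  (fun x => hat a h i.+1 x * hat a h j.+1 x)
  (h / 6 * (if i == j then 4 else if i == j.+1 then 1 else if j == i.+1 then 1 else 0)).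
Proof.
(* the four products of one of the two cells of each hat; a product survives
   only when the two cells coincide *)
have E x : hat a h i.+1 x * hat a h j.+1 x =
    (i == j)%:R * (cell_quad i 0 0 1 x) + (i == j.+1)%:R * cell_quad i 0 1 (-1) x
    + (i.+1 == j)%:R * cell_quad i.+1 0 1 (-1) x
    + (i == j)%:R * cell_quad i.+1 1 (-2) 1 x.
  have mulE (e f e' f' A B A' B' : R) : (e * A + f * B) * (e' * A' + f' * B') =
    e * e' * (A * A') + e * f' * (A * B') + f * e' * (B * A') + f * f' * (B * B').
    by ring.
  rewrite !hat_cells mulE !indic_cellM eqSS /cell_quad; do ?congr (_ + _).
  - by case: eqP => [->|_] /=; ring.
  - by case: eqP => [->|_] /=; ring.
  - by case: eqP => [->|_] /=; ring.
  - by case: eqP => [->|_] /=; ring.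
under eq_fun do rewrite E.
rewrite (_ : h / 6 * _ = (i == j)%:R * (h * (0 + 0 / 2 + 1 / 3))
  + (i == j.+1)%:R * (h * (0 + 1 / 2 + -1 / 3))
  + (i.+1 == j)%:R * (h * (0 + 1 / 2 + -1 / 3))
  + (i == j)%:R * (h * (1 + -2 / 2 + 1 / 3))); last first.
  have [->|ij] := eqVneq i j.
    by rewrite ?eqxx ltn_eqF// gtn_eqF//=; field.
  rewrite [j == i.+1]eq_sym; have [->|_] := eqVneq i j.+1.
    by rewrite !gtn_eqF//=; field.
  by case: (i.+1 == j) => /=; field.
by do ?apply: has_integralD; apply: has_integralZ; exact: integral_cell_quad.
Qed.

Lemma integral_hat_slope_mul i j : has_integral leb
  (fun x => hat_slope a h i.+1 x * hat_slope a h j.+1 x)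
  (h^-1 * (if i == j then 2 else if i == j.+1 then -1 else if j == i.+1 then -1 else 0)).
Proof.
have E x : hat_slope a h i.+1 x * hat_slope a h j.+1 x =
    h^-1 ^+ 2 * ((i == j)%:R * (cell_quad i 1 0 0 x) + - (i == j.+1)%:R * cell_quad i 1 0 0 x
    + - (i.+1 == j)%:R * cell_quad i.+1 1 0 0 x
    + (i == j)%:R * cell_quad i.+1 1 0 0 x).
  have mulE (e f e' f' : R) : h^-1 * (e - f) * (h^-1 * (e' - f')) =
    h^-1 ^+ 2 * (e * e' - e * f' - f * e' + f * f') by ring.
  rewrite /hat_slope mulE /= !indic_cellM eqSS /cell_quad; congr (_ * _); ring.
under eq_fun do rewrite E.
rewrite (_ : h^-1 * _ = h^-1 ^+ 2 * ((i == j)%:R * (h * (1 + 0 / 2 + 0 / 3))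
  + - (i == j.+1)%:R * (h * (1 + 0 / 2 + 0 / 3))
  + - (i.+1 == j)%:R * (h * (1 + 0 / 2 + 0 / 3))
  + (i == j)%:R * (h * (1 + 0 / 2 + 0 / 3)))); last first.
  have hn0 : h != 0 by exact: lt0r_neq0.
  have [->|ij] := eqVneq i j.
    by rewrite ?eqxx ltn_eqF// gtn_eqF//=; field.
  rewrite [j == i.+1]eq_sym; have [->|_] := eqVneq i j.+1.
    by rewrite !gtn_eqF//=; field.
  by case: (i.+1 == j) => /=; field.
apply: has_integralZ.
by do ?apply: has_integralD; apply: has_integralZ; exact: integral_cell_quad.
Qed.

End hat_integrals.

(** * Comparison of integrals and dependence on a parameter *)

Section comparison.
Context {d} {T : measurableType d} {R : realType}.
Variable mu : {measure set T -> \bar R}.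

(** Both estimates of the double integral, in s and in x, have this form. *)
Lemma has_integral_close (f g e : T -> R) (v w : R) :
  measurable_fun setT f -> has_integral mu g v -> has_integral mu e w ->
  (forall x, `|f x - g x| <= e x) ->
  exists z, has_integral mu f z /\ `|z - v| <= w.
Proof.
move=> mf [gi gv] [ei ew] fge.
have mg : measurable_fun setT g by apply/measurable_EFinP; exact: measurable_int gi.
have fgi : mu.-integrable setT (EFin \o (f \- g)).
  apply: le_integrable ei => //.
    by apply/measurable_EFinP; exact: measurable_funB.
  by move=> x _ /=; rewrite lee_fin (le_trans (fge x))// ler_norm.
pose k := fine (\int[mu]_x (f x - g x)%:E)%E.
have kE : (\int[mu]_x (f x - g x)%:E)%E = k%:E.
  by rewrite fineK// integrable_fin_num.
exists (v + k); split.
  have -> : f = fun x => g x + (f x - g x) by apply/funext => x; rewrite addrC subrK.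
  by apply: has_integralD; split.
rewrite addrC addKr -lee_fin -ew -[(`|k|)%:E]/(`|k%:E|)%E -kE.
have mfg : measurable_fun setT (fun x => (f x - g x)%:E) by exact: measurable_int fgi.
apply: le_trans (le_abse_integral mu measurableT mfg) _.
apply: ge0_le_integral => //; first exact: measurableT_comp.
  exact: measurable_int ei.
by move=> x _; rewrite lee_fin.
Qed.
End comparison.

HB.instance Definition _ (R : realType) := Measure.copy (@lebesgue2 R)
  (product_measure1 (@lebesgue_measure R) (@lebesgue_measure R)).

Section lebesgue2_sigma_finite.
Context {R : realType}.

(** Sets F_n of finite measure exhausting the line give squares F_n x F_n that
exhaust the plane; measurability of a parametric integral rests on this. *)
Let lebesgue2_sigma_finite : sigma_finite setT (@lebesgue2 R).
Proof.
have /sigma_finiteP[F [TF ndF Foo]] := sigma_finiteT (@lebesgue_measure R).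
exists (fun n => F n `*` F n).
  rewrite -setXTT TF predeqE => -[x y]; split.
    move=> [/= [n _ Fnx] [k _ Gky]]; exists (maxn n k) => //; split.
    - by move: x Fnx; exact/subsetPset/ndF/leq_maxl.
    - by move: y Gky; exact/subsetPset/ndF/leq_maxr.
  by move=> [n _ []/= ? ?]; split; exists n.
move=> k; have [? ?] := Foo k; split; first exact: measurableX.
by rewrite /lebesgue2 product_measure1E// lte_mul_pinfty// ge0_fin_numE.
Qed.

HB.instance Definition _ := Measure_isSigmaFinite.Build _ _ _ (@lebesgue2 R)
  lebesgue2_sigma_finite.
End lebesgue2_sigma_finite.

Section param.
Context {d1 d2} {T1 : measurableType d1} {T2 : measurableType d2} {R : realType}.
Variable mu : {sigma_finite_measure set T2 -> \bar R}.

(** Tonelli gives measurability for nonnegative functions, hence for the positive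
and the negative part separately. *)
Lemma measurable_integral_param (f : T1 * T2 -> \bar R) :
  measurable_fun setT f -> measurable_fun setT (fun x => \int[mu]_y f (x, y))%E.
Proof.
move=> mf; under eq_fun do rewrite integralE.
apply: emeasurable_funB.
  rewrite (_ : (fun x => _) = fubini_F mu (f^\+)%E).
    by apply: measurable_fun_fubini_tonelli_F => //; exact: measurable_funepos.
  by apply/funext => x; apply: eq_integral => y _; rewrite !funeposE.
rewrite (_ : (fun x => _) = fubini_F mu (f^\-)%E).
  by apply: measurable_fun_fubini_tonelli_F => //; exact: measurable_funeneg.
by apply/funext => x; apply: eq_integral => y _; rewrite !funenegE.
Qed.
End param.

(** * Increments of bilinear hat functions *)

Section bilinear_hat.
Context {R : realType}.
Notation leb := (@lebesgue_measure R).
Notation leb2 := (@lebesgue_measure R \x @lebesgue_measure R)%E.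
Variables a1 a2 h : R.
Hypothesis h0 : 0 < h.
Implicit Types (i j : nat) (x s : R * R) (e r : R).

Definition hat2 i1 i2 x : R := hat a1 h i1.+1 x.1 * hat a2 h i2.+1 x.2.
Definition hat2_dx i1 i2 x : R := hat_slope a1 h i1.+1 x.1 * hat a2 h i2.+1 x.2.
Definition hat2_dy i1 i2 x : R := hat a1 h i1.+1 x.1 * hat_slope a2 h i2.+1 x.2.
Definition kinks2 e i1 i2 x : R := kinks a1 h e i1.+1 x.1 + kinks a2 h e i2.+1 x.2.

Definition hat2_increment i1 i2 x s : R :=
  hat2 i1 i2 (x.1 + s.1, x.2 + s.2) - hat2 i1 i2 x.
Definition hat2_differential i1 i2 x s : R :=
  s.1 * hat2_dx i1 i2 x + s.2 * hat2_dy i1 i2 x.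

Lemma hat_norm_le1 a n (y : R) : `|hat a h n.+1 y| <= 1.
Proof. by have /andP[? ?] := hat_ge0_le1 a h h0 n y; rewrite ger0_norm. Qed.

Lemma enorm2_ge0 s : 0 <= enorm2 s. Proof. exact: sqrtr_ge0. Qed.

Lemma norm_fst_le s : `|s.1| <= enorm2 s.
Proof. by rewrite -sqrtr_sqr ler_sqrt ?sqnorm_ge0// lerDl sqr_ge0. Qed.

Lemma norm_snd_le s : `|s.2| <= enorm2 s.
Proof. by rewrite -sqrtr_sqr ler_sqrt ?sqnorm_ge0// lerDr sqr_ge0. Qed.

Lemma normM_le (p q P Q : R) : `|p| <= P -> `|q| <= Q -> `|p * q| <= P * Q.
Proof. by move=> pP qQ; rewrite normrM ler_pM. Qed.

Lemma hat2_increment_le i1 i2 x s :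
  `|hat2_increment i1 i2 x s| <= 2 * h^-1 * enorm2 s.
Proof.
have L0 : 0 <= h^-1 by rewrite invr_ge0 ltW.
have -> : hat2_increment i1 i2 x s =
    (hat a1 h i1.+1 (x.1 + s.1) - hat a1 h i1.+1 x.1) * hat a2 h i2.+1 (x.2 + s.2)
    + hat a1 h i1.+1 x.1 * (hat a2 h i2.+1 (x.2 + s.2) - hat a2 h i2.+1 x.2).
  by rewrite /hat2_increment /hat2/=; ring.
rewrite (le_trans (ler_normD _ _))// -mulrA mulr_natl mulr2n lerD//.
  rewrite -[leRHS]mulr1; apply: normM_le; last exact: hat_norm_le1.
  by rewrite (le_trans (hat_lipschitz _ _ h0 _ _ _))// ler_wpM2l// norm_fst_le.
rewrite -[leRHS]mul1r; apply: normM_le; first exact: hat_norm_le1.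
by rewrite (le_trans (hat_lipschitz _ _ h0 _ _ _))// ler_wpM2l// norm_snd_le.
Qed.

Lemma hat2_differential_le i1 i2 x s :
  `|hat2_differential i1 i2 x s| <= 2 * h^-1 * enorm2 s.
Proof.
have L0 : 0 <= h^-1 by rewrite invr_ge0 ltW.
have -> : 2 * h^-1 * enorm2 s = enorm2 s * (h^-1 * 1) + enorm2 s * (1 * h^-1) by ring.
rewrite (le_trans (ler_normD _ _))// lerD//.
  apply: normM_le; first exact: norm_fst_le.
  by apply: normM_le; [exact: hat_slope_le|exact: hat_norm_le1].
apply: normM_le; first exact: norm_snd_le.
by apply: normM_le; [exact: hat_norm_le1|exact: hat_slope_le].
Qed.

(** With p, q the two factors, the increment of p q is
(Delta p) q + p (Delta q) + (Delta p) (Delta q), and the last term is O(|s|^2). *)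
Lemma hat2_increment_differential e i1 i2 x s : e < h -> enorm2 s <= e ->
  `|hat2_increment i1 i2 x s - hat2_differential i1 i2 x s| <=
    2 * h^-1 * enorm2 s * kinks2 e i1 i2 x + (h^-1 * enorm2 s) ^+ 2.
Proof.
move=> eh se.
have L0 : 0 <= h^-1 by rewrite invr_ge0 ltW.
have s1e : `|s.1| <= e by rewrite (le_trans (norm_fst_le s)).
have s2e : `|s.2| <= e by rewrite (le_trans (norm_snd_le s)).
set p := hat a1 h i1.+1 x.1; set p' := hat a1 h i1.+1 (x.1 + s.1).
set q := hat a2 h i2.+1 x.2; set q' := hat a2 h i2.+1 (x.2 + s.2).
have -> : hat2_increment i1 i2 x s - hat2_differential i1 i2 x s =
    (p' - p - s.1 * hat_slope a1 h i1.+1 x.1) * q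
    + p * (q' - q - s.2 * hat_slope a2 h i2.+1 x.2) + (p' - p) * (q' - q).
  rewrite /hat2_increment /hat2_differential /hat2 /hat2_dx /hat2_dy/=.
  by rewrite -/p -/p' -/q -/q'; ring.
rewrite (le_trans (ler_normD _ _))// lerD//; last first.
  apply: normM_le.
    by rewrite (le_trans (hat_lipschitz _ _ h0 _ _ _))// ler_wpM2l// norm_fst_le.
  by rewrite (le_trans (hat_lipschitz _ _ h0 _ _ _))// ler_wpM2l// norm_snd_le.
rewrite (le_trans (ler_normD _ _))// /kinks2 [leRHS]mulrDr lerD//.
  rewrite -[leRHS]mulr1; apply: normM_le; last exact: hat_norm_le1.
  rewrite (le_trans (hat_increment _ _ h0 e _ _ _ eh s1e))// ler_wpM2r ?kinks_ge0//.
  by rewrite ler_wpM2l ?mulr_ge0// norm_fst_le.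
rewrite -[leRHS]mul1r; apply: normM_le; first exact: hat_norm_le1.
rewrite (le_trans (hat_increment _ _ h0 e _ _ _ eh s2e))// ler_wpM2r ?kinks_ge0//.
by rewrite ler_wpM2l ?mulr_ge0// norm_snd_le.
Qed.

(** Both the increments and the differentials are at most 2 |s| / h, so the error
on each factor gets multiplied by that. *)
Lemma increment_mul_close e i1 i2 j1 j2 x s : e < h -> enorm2 s <= e ->
  `|hat2_increment i1 i2 x s * hat2_increment j1 j2 x s
    - hat2_differential i1 i2 x s * hat2_differential j1 j2 x s| <=
  (4 * h^-1 ^+ 2 * (kinks2 e i1 i2 x + kinks2 e j1 j2 x) + 4 * h^-1 ^+ 3 * e)
    * sqnorm s.
Proof.
move=> eh se.
have L0 : 0 <= h^-1 by rewrite invr_ge0 ltW.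
have r0 := enorm2_ge0 s.
have sE : sqnorm s = enorm2 s ^+ 2 by rewrite sqr_sqrtr// sqnorm_ge0.
have -> : hat2_increment i1 i2 x s * hat2_increment j1 j2 x s
    - hat2_differential i1 i2 x s * hat2_differential j1 j2 x s =
  hat2_increment i1 i2 x s * (hat2_increment j1 j2 x s - hat2_differential j1 j2 x s)
  + (hat2_increment i1 i2 x s - hat2_differential i1 i2 x s) * hat2_differential j1 j2 x s.
  by ring.
rewrite (le_trans (ler_normD _ _))//.
have := normM_le _ _ _ _ (hat2_increment_le i1 i2 x s) (hat2_increment_differential e j1 j2 x s eh se).
have := normM_le _ _ _ _ (hat2_increment_differential e i1 i2 x s eh se) (hat2_differential_le j1 j2 x s).
rewrite sE; set r := enorm2 s in r0 se *; set L := h^-1 in L0 *.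
set ku := kinks2 _ _ _ _; set kv := kinks2 _ _ _ _; move=> Eu Ev.
rewrite (le_trans (lerD Ev Eu))//.
rewrite [leLHS](_ : _ = (4 * L ^+ 2 * (ku + kv)) * r ^+ 2 + (4 * L ^+ 3 * r) * r ^+ 2); last by ring.
rewrite [leRHS]mulrDl lerD2l ler_wpM2r ?sqr_ge0// ler_wpM2l// mulr_ge0// exprn_ge0//.
Qed.

End bilinear_hat.

(** * Consistency error of the nonlocal form *)

Section form_estimate.
Context {R : realType}.
Notation leb := (@lebesgue_measure R).
Notation leb2 := (@lebesgue_measure R \x @lebesgue_measure R)%E.
Variables a1 a2 b1 b2 h alpha delta : R.
Hypotheses (h0 : 0 < h) (delta0 : 0 < delta) (deltah : delta < h).
Hypothesis alpha2 : alpha < 2.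
Variables i1 i2 j1 j2 : nat.
Implicit Types (x s : R * R).

Notation w := (kernel_weight alpha delta).
Notation Du := (hat2_increment a1 a2 h i1 i2).
Notation Dv := (hat2_increment a1 a2 h j1 j2).
Notation du := (hat2_differential a1 a2 h i1 i2).
Notation dv := (hat2_differential a1 a2 h j1 j2).

Definition grad_mul x : R :=
  hat2_dx a1 a2 h i1 i2 x * hat2_dx a1 a2 h j1 j2 x
  + hat2_dy a1 a2 h i1 i2 x * hat2_dy a1 a2 h j1 j2 x.

(** The factor of |s|^2 in [increment_mul_close], with e = delta. *)
Definition kink_bound x : R :=
  4 * h^-1 ^+ 2 * (kinks2 a1 a2 h delta i1 i2 x + kinks2 a1 a2 h delta j1 j2 x)
  + 4 * h^-1 ^+ 3 * delta.

Lemma measurable_hat2 k1 k2 : measurable_fun setT (hat2 a1 a2 h k1 k2).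
Proof.
apply: measurable_funM.
  exact: measurableT_comp (measurable_hat a1 h h0 k1) measurable_fst.
exact: measurableT_comp (measurable_hat a2 h h0 k2) measurable_snd.
Qed.

Lemma measurable_increment k1 k2 : measurable_fun setT
  (fun xs : (R * R) * (R * R) => hat2_increment a1 a2 h k1 k2 xs.1 xs.2).
Proof.
apply: measurable_funB; last exact: measurableT_comp (measurable_hat2 k1 k2) measurable_fst.
apply: measurableT_comp (measurable_hat2 k1 k2) _.
apply/measurable_fun_pairP; split; apply: measurable_funD.
- exact: measurableT_comp measurable_fst measurable_fst.
- exact: measurableT_comp measurable_fst measurable_snd.
- exact: measurableT_comp measurable_snd measurable_fst.
- exact: measurableT_comp measurable_snd measurable_snd.
Qed.

Definition density (xs : (R * R) * (R * R)) : R :=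
  Du xs.1 xs.2 * Dv xs.1 xs.2 * w xs.2.

Lemma measurable_density : measurable_fun setT density.
Proof.
apply: measurable_funM; first by apply: measurable_funM; exact: measurable_increment.
exact: measurableT_comp (measurable_kernel_weight _ _) measurable_snd.
Qed.

Lemma inner_integral x : exists z,
  has_integral leb2 (fun s => density (x, s)) z /\
  `|z - 2 * grad_mul x| <= 4 * kink_bound x.
Proof.
have w0 := kernel_weight_ge0 alpha delta alpha2.
apply: (@has_integral_close _ _ _ leb2 _ (fun s => du x s * dv x s * w s)
   (fun s => kink_bound x * (sqnorm s * w s))).
- exact: measurableT_comp measurable_density (measurable_pair1 _).
- pose a := hat2_dx a1 a2 h i1 i2 x * hat2_dx a1 a2 h j1 j2 x.
  pose c := hat2_dy a1 a2 h i1 i2 x * hat2_dy a1 a2 h j1 j2 x.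
  pose b := hat2_dx a1 a2 h i1 i2 x * hat2_dy a1 a2 h j1 j2 x
          + hat2_dy a1 a2 h i1 i2 x * hat2_dx a1 a2 h j1 j2 x.
  have E s : du x s * dv x s * w s =
      (a * s.1 ^+ 2 + b * (s.1 * s.2) + c * s.2 ^+ 2) * w s.
    by rewrite /hat2_differential /a /b /c; ring.
  under eq_fun do rewrite E.
  split; first exact: integrable_kernel_quad.
  exact: integral_kernel_quad.
- rewrite mulrC; apply: has_integralZ; apply: has_integralP.
    by apply: measurable_funM; [exact: measurable_sqnorm|exact: measurable_kernel_weight].
  exact: integral_sqnorm_kernel_weight.
- move=> s; rewrite /density/= -mulrBl normrM [`|w s|]ger0_norm// mulrA.
  have [sd|sd] := boolP (s \in disc delta).
    rewrite ler_wpM2r// increment_mul_close//.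
    by move: sd; rewrite inE => /ltW.
  by rewrite /kernel_weight indicE (negbTE sd) !mulr0.
Qed.

Lemma has_integral_indic_itv (i : interval R) (c d : R) (b b' : bool) :
  c < d -> i = Interval (BSide b c) (BSide b' d) ->
  has_integral leb (\1_[set` i]) (d - c).
Proof.
move=> cd ->; apply: has_integralP; first by apply: measurable_indic; exact: measurable_itv.
rewrite integral_indic// setIT [LHS]lebesgue_measure_itv/= lte_fin cd.
by rewrite EFinB.
Qed.

Lemma integral_kinks a n : has_integral leb (kinks a h delta n) (6 * delta).
Proof.
have -> : kinks a h delta n = fun y =>
    \1_`[node a h (n.-1 + 0) - delta, node a h (n.-1 + 0) + delta] y
  + \1_`[node a h (n.-1 + 1) - delta, node a h (n.-1 + 1) + delta] y
  + \1_`[node a h (n.-1 + 2) - delta, node a h (n.-1 + 2) + delta] y.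
  by apply/funext => y; rewrite /kinks !big_ord_recr big_ord0/= add0r.
have -> : 6 * delta = 2 * delta + 2 * delta + 2 * delta by ring.
have I k : has_integral leb (\1_`[node a h k - delta, node a h k + delta]) (2 * delta).
  have -> : 2 * delta = (node a h k + delta) - (node a h k - delta) by ring.
  apply: has_integral_indic_itv; last reflexivity.
  by rewrite ltrD2l gtrN.
by do ?apply: has_integralD; exact: I.
Qed.

Hypotheses (ab1 : a1 < b1) (ab2 : a2 < b2).
Notation E1 := `]a1 - delta, b1 + delta[%classic.
Notation E2 := `]a2 - delta, b2 + delta[%classic.
Notation D := (extended_domain a1 b1 a2 b2 delta).

(** Equal to 4 [kink_bound] on the extended domain, but written with indicators
as a sum of tensor products so that its integral is a sum of products. *)
Definition domain_bound x : R := 4 * (4 * h^-1 ^+ 2 *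
  ((kinks a1 h delta i1.+1 x.1 + kinks a1 h delta j1.+1 x.1) * \1_E2 x.2
   + \1_E1 x.1 * (kinks a2 h delta i2.+1 x.2 + kinks a2 h delta j2.+1 x.2))
  + 4 * h^-1 ^+ 3 * delta * (\1_E1 x.1 * \1_E2 x.2)).

Lemma integral_domain_bound : has_integral leb2 domain_bound
  (4 * (4 * h^-1 ^+ 2 *
    ((6 * delta + 6 * delta) * (b2 + delta - (a2 - delta))
     + (b1 + delta - (a1 - delta)) * (6 * delta + 6 * delta))
   + 4 * h^-1 ^+ 3 * delta *
     ((b1 + delta - (a1 - delta)) * (b2 + delta - (a2 - delta))))).
Proof.
have d0 := delta0.
have I1 : has_integral leb (\1_E1) (b1 + delta - (a1 - delta)).
  by apply: has_integral_indic_itv; [have := ab1; lra|reflexivity].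
have I2 : has_integral leb (\1_E2) (b2 + delta - (a2 - delta)).
  by apply: has_integral_indic_itv; [have := ab2; lra|reflexivity].
apply: has_integralZ; apply: has_integralD; apply: has_integralZ.
  apply: has_integralD.
    apply: (@has_integral_tensor _ (fun y => _ + _)) => //.
    by apply: has_integralD; exact: integral_kinks.
  apply: (@has_integral_tensor _ _ (fun y => _ + _)) => //.
  by apply: has_integralD; exact: integral_kinks.
exact: has_integral_tensor.
Qed.

Lemma in_domain x : (x \in D) = (x.1 \in E1) && (x.2 \in E2).
Proof.
apply/idP/andP => [|[]]; first by rewrite inE => -[? ?]; split; rewrite inE.
by rewrite !inE => ? ?; split.
Qed.

Lemma measurable_domain : measurable (D : set (R * R)).
Proof. by apply: measurableX; exact: measurable_itv. Qed.

Lemma domain_bound_ge0 x : 0 <= domain_bound x.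
Proof.
have L0 : 0 <= h^-1 by rewrite invr_ge0 ltW.
rewrite mulr_ge0// addr_ge0// !mulr_ge0 ?exprn_ge0 ?(ltW delta0) ?indicE//.
by rewrite addr_ge0// mulr_ge0// addr_ge0// kinks_ge0.
Qed.

Lemma kink_bound_domain x : x \in D -> 4 * kink_bound x = domain_bound x.
Proof.
rewrite in_domain => /andP[x1 x2].
rewrite /domain_bound /kink_bound /kinks2 !indicE x1 x2 /=; ring.
Qed.

(** All the terms of the bound are O(delta): each neighbourhood of a kink has
width 2 delta. *)
Lemma form_close (Q : R) : has_integral leb2 grad_mul Q ->
  (forall x, x \notin D -> grad_mul x = 0) ->
  `|nonlocal_form a1 b1 a2 b2 delta (rho alpha delta)
      (hat2 a1 a2 h i1 i2) (hat2 a1 a2 h j1 j2) - Q| <=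
  2 * (4 * h^-1 ^+ 2 *
    ((6 * delta + 6 * delta) * (b2 + delta - (a2 - delta))
     + (b1 + delta - (a1 - delta)) * (6 * delta + 6 * delta))
   + 4 * h^-1 ^+ 3 * delta *
     ((b1 + delta - (a1 - delta)) * (b2 + delta - (a2 - delta)))).
Proof.
move=> IQ grad0.
pose J x := fine (\int[@lebesgue2 R]_s (density (x, s))%:E)%E.
have mJ : measurable_fun setT J.
  apply: measurableT_comp => //.
  apply: (@measurable_integral_param _ _ _ _ R (@lebesgue2 R) (fun xs => (density xs)%:E)).
  by apply/measurable_EFinP; exact: measurable_density.
have JE x : (\int[@lebesgue2 R]_s (density (x, s))%:E)%E = (J x)%:E.
  by have [z [[_ Iz] _]] := inner_integral x; rewrite /J [in LHS]Iz [in RHS]Iz.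
have Jclose x : `|J x - 2 * grad_mul x| <= 4 * kink_bound x.
  have [z [[_ Iz] ?]] := inner_integral x.
  by have -> : J x = z by rewrite /J [X in fine X]Iz.
have formE : nonlocal_form a1 b1 a2 b2 delta (rho alpha delta)
      (hat2 a1 a2 h i1 i2) (hat2 a1 a2 h j1 j2) =
    2^-1 * fine (\int[leb2]_x ((J \_ D) x)%:E)%E.
  rewrite /nonlocal_form; congr (_ * fine _).
  rewrite integral_mkcond; apply: eq_integral => x _.
  rewrite !patchE; case: ifP => // xD.
  rewrite -JE integral_mkcond; apply: eq_integral => s _.
  rewrite patchE /density /kernel_weight indicE.
  by case: ifP => _; rewrite ?mulr1 ?mulr0.
have [z [[_ Iz] zQ]] : exists z, has_integral leb2 (J \_ D) z /\
    `|z - 2 * Q| <= 4 * (4 * h^-1 ^+ 2 *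
    ((6 * delta + 6 * delta) * (b2 + delta - (a2 - delta))
     + (b1 + delta - (a1 - delta)) * (6 * delta + 6 * delta))
   + 4 * h^-1 ^+ 3 * delta *
     ((b1 + delta - (a1 - delta)) * (b2 + delta - (a2 - delta)))).
  apply: has_integral_close (has_integralZ _ 2 _ _ IQ) integral_domain_bound _.
    by apply/(measurable_restrictT _ measurable_domain); exact: measurable_funTS.
  move=> x; rewrite patchE; case: ifPn => xD; first by rewrite -kink_bound_domain.
  by rewrite grad0// mulr0 subrr normr0 domain_bound_ge0.
rewrite formE Iz /=.
have -> : 2^-1 * z - Q = 2^-1 * (z - 2 * Q) by field.
rewrite normrM ger0_norm// ler_pdivrMl//; apply: le_trans zQ _.
by rewrite [leRHS]mulrA -natrM.
Qed.

End form_estimate.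

(** * Convergence to the FEM stiffness matrix *)

Section fem_limit.
Context {R : realType}.
Notation leb2 := (@lebesgue_measure R \x @lebesgue_measure R)%E.
Implicit Types (a b h e : R) (x : R * R).

Lemma tridiagE n (lo d up : R) (i j : 'I_n) : tridiag n lo d up i j =
  if (i == j :> nat) then d else if (i == j.+1 :> nat) then lo
  else if (j == i.+1 :> nat) then up else 0.
Proof. by rewrite mxE. Qed.

Lemma integral_grad_mul a1 a2 h (N1 N2 : nat) (i1 j1 : 'I_N1) (i2 j2 : 'I_N2) :
  0 < h -> has_integral leb2 (grad_mul a1 a2 h i1 i2 j1 j2)
    (fem_stiffness h N2 i2 j2 * fem_mass h N1 i1 j1
     + fem_mass h N2 i2 j2 * fem_stiffness h N1 i1 j1).
Proof.
move=> h0; have -> : grad_mul a1 a2 h i1 i2 j1 j2 = fun x =>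
    (hat a1 h i1.+1 x.1 * hat a1 h j1.+1 x.1)
    * (hat_slope a2 h i2.+1 x.2 * hat_slope a2 h j2.+1 x.2)
  + (hat_slope a1 h i1.+1 x.1 * hat_slope a1 h j1.+1 x.1)
    * (hat a2 h i2.+1 x.2 * hat a2 h j2.+1 x.2).
  by apply/funext => x; rewrite /grad_mul /hat2_dx /hat2_dy; ring.
rewrite [X in X + _]mulrC [X in _ + X]mulrC ![fem_stiffness _ _ _ _]mxE ![fem_mass _ _ _ _]mxE.
rewrite !tridiagE.
apply: has_integralD.
  apply: (@has_integral_tensor _ (fun y => _ * _) (fun y => _ * _)).
    exact: integral_hat_mul.
  exact: integral_hat_slope_mul.
apply: (@has_integral_tensor _ (fun y => _ * _) (fun y => _ * _)).
  exact: integral_hat_slope_mul.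
exact: integral_hat_mul.
Qed.

Lemma hat_support a h n (y : R) : 0 < h -> ~~ (node a h n < y <= node a h n.+2) ->
  hat a h n.+1 y = 0 /\ hat_slope a h n.+1 y = 0.
Proof.
move=> h0 yN; have n1 := nodeS a h n; have n2 := nodeS a h n.+1.
have [/negbTE y1 /negbTE y2] : y \notin cell a h n /\ y \notin cell a h n.+1.
  rewrite !in_cell; split; apply: contra yN => /andP[? ?]; apply/andP; split; lra.
rewrite hat_cells// /hat_slope !indicE y1 y2; split; last by rewrite subrr mulr0.
by rewrite !mul0r addr0.
Qed.

Lemma node_le a b h N i : 0 < h -> h = (b - a) / (N + 1)%:R -> (i <= N.+1)%N ->
  a <= node a h i <= b.
Proof.
move=> h0 hE iN; have h0' := ltW h0; rewrite /node lerDl mulr_ge0//=.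
have -> : b = a + (N + 1)%:R * h.
  by rewrite hE mulrC divfK ?pnatr_eq0 ?addn1// addrC subrK.
by rewrite lerD2l ler_pM2r// ler_nat addn1.
Qed.

(** The hats at interior nodes are supported in [a, b], so that integrating over
the extended domain or over the plane makes no difference. *)
Lemma hat_vanish a b h N i e (y : R) : 0 < h -> h = (b - a) / (N + 1)%:R ->
  (i < N)%N -> 0 < e -> y \notin `]a - e, b + e[%classic ->
  hat a h i.+1 y = 0 /\ hat_slope a h i.+1 y = 0.
Proof.
move=> h0 hE iN e0 yN; apply: hat_support => //; apply: contra yN => /andP[y1 y2].
have /andP[? _] := node_le _ _ _ _ i h0 hE (leqW (ltnW iN)).
have /andP[_ ?] := node_le _ _ _ _ i.+2 h0 hE iN.
by rewrite inE /= in_itv/=; apply/andP; split; lra.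
Qed.

End fem_limit.

Theorem mainTheorem4 (R : realType) (a1 b1 a2 b2 h : R) (N1 N2 : nat)
    (alpha : R) (hab1 : a1 < b1) (hab2 : a2 < b2)
    (hN1 : (1 <= N1)%N) (hN2 : (1 <= N2)%N)
    (hh1 : h = (b1 - a1) / (N1 + 1)%:R) (hh2 : h = (b2 - a2) / (N2 + 1)%:R)
    (halpha : -1 <= alpha < 2) :
  forall l l' : 'I_(N2 * N1),
    nonlocal_stiffness a1 b1 a2 b2 h N1 N2 alpha delta l l'
      @[delta --> 0^'+] -->
    (fem_stiffness h N2 *t fem_mass h N1
      + fem_mass h N2 *t fem_stiffness h N1) l l'.
Proof.
move=> l l'; have /andP[_ alpha2] := halpha.
have h0 : 0 < h by rewrite hh1 divr_gt0 ?subr_gt0// addn1.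
have L0 : 0 <= h^-1 by rewrite invr_ge0 ltW.
pose i := mxtens_unindex l; pose j := mxtens_unindex l'.
have -> : (fem_stiffness h N2 *t fem_mass h N1
      + fem_mass h N2 *t fem_stiffness h N1) l l' =
    fem_stiffness h N2 i.1 j.1 * fem_mass h N1 i.2 j.2
    + fem_mass h N2 i.1 j.1 * fem_stiffness h N1 i.2 j.2.
  rewrite -(mxtens_unindexK l) -(mxtens_unindexK l') -/i -/j.
  by case: i j => [? ?] [? ?]; rewrite [LHS]mxE !tensmxE.
set Q := (X in _ --> X).
(* for delta < 1 the bound of form_close is at most delta K *)
pose K := 2 * (4 * h^-1 ^+ 2 * (12 * (b2 - a2 + 2) + (b1 - a1 + 2) * 12)
  + 4 * h^-1 ^+ 3 * ((b1 - a1 + 2) * (b2 - a2 + 2))).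
have close delta : 0 < delta -> delta < h -> delta < 1 ->
    `|nonlocal_stiffness a1 b1 a2 b2 h N1 N2 alpha delta l l' - Q| <= delta * K.
  move=> d0 dh d1; rewrite mxE.
  have := form_close a1 a2 b1 b2 h alpha delta h0 d0 dh alpha2 i.2 i.1 j.2 j.1
    hab1 hab2 Q.
  move=> /(_ (integral_grad_mul _ _ _ _ _ _ _ _ _ h0)).
  have grad0 x : x \notin extended_domain a1 b1 a2 b2 delta ->
      grad_mul a1 a2 h i.2 i.1 j.2 j.1 x = 0.
    rewrite in_domain negb_and => /orP[xN|xN]; rewrite /grad_mul /hat2_dx /hat2_dy.
      have [-> ->] := hat_vanish _ _ _ _ i.2 _ _ h0 hh1 (ltn_ord _) d0 xN.
      by rewrite !mul0r addr0.
    have [-> ->] := hat_vanish _ _ _ _ i.1 _ _ h0 hh2 (ltn_ord _) d0 xN.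
    by rewrite !mulr0 !mul0r addr0.
  move=> /(_ grad0) /le_trans; apply.
  rewrite /K; set L := h^-1 in L0 *.
  set l1 := b1 + delta - (a1 - delta); set l2 := b2 + delta - (a2 - delta).
  have l1E : 0 <= l1 <= b1 - a1 + 2 by rewrite /l1; apply/andP; split; lra.
  have l2E : 0 <= l2 <= b2 - a2 + 2 by rewrite /l2; apply/andP; split; lra.
  move: l1E l2E => /andP[l10 l1E] /andP[l20 l2E].
  have -> : 2 * (4 * L ^+ 2 * ((6 * delta + 6 * delta) * l2 + l1 * (6 * delta + 6 * delta))
      + 4 * L ^+ 3 * delta * (l1 * l2)) =
    delta * (2 * (4 * L ^+ 2 * (12 * l2 + l1 * 12) + 4 * L ^+ 3 * (l1 * l2))) by ring.
  rewrite ler_pM2l// ler_pM2l// lerD// ler_wpM2l ?mulr_ge0 ?exprn_ge0//.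
    by rewrite lerD// ?ler_pM2l// ler_pM2r.
  by rewrite ler_pM.
have K0 : 0 <= K.
  have l1 : 0 <= b1 - a1 + 2 by lra.
  have l2 : 0 <= b2 - a2 + 2 by lra.
  by rewrite /K !(l1, l2, mulr_ge0, addr_ge0, exprn_ge0).
apply/cvgrPdist_le => e e0.
near=> delta.
have d0 : 0 < delta by near: delta; exact: nbhs_right_gt.
have dh : delta < h by near: delta; exact: nbhs_right_lt.
have d1 : delta < 1 by near: delta; exact: nbhs_right_lt.
have de : delta < e / (K + 1).
  by near: delta; apply: nbhs_right_lt; rewrite divr_gt0// ltr_wpDl.
rewrite distrC (le_trans (close delta d0 dh d1))//.
move: de; rewrite ltr_pdivlMr ?ltr_wpDl// => /ltW; apply: le_trans.
by rewrite ler_pM2l// lerDl.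
Unshelve. all: by end_near. Qed.
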